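(* Let $b:[-1,1]\to[0,1]$ be a perception base function, let $p\ge 2$ be an integer (the perception resolution), and let $$G_p=\{-1,0,+1\}\cup\Big\{\pm\frac{2^{p-2}-j}{2^{p-2}} : j=1,2,\dots,2^{p-2}-1\Big\}.$$ Let $f:G_p\to[0,1]$ be any function given by its values at the points of $G_p$. Then $f$ can be fully represented by the multi-perceptual representation of resolution $p$ built from $b$: there exist real weights $w_{-1},w_{+1}$, $w'_0$, and, for each $3\le i\le p$ and $1\le j\le 2^{i-3}$, real weights $w'_{c_{i,j}}$ and $w'_{-c_{i,j}}$, where $c_{i,j}=\frac{2^{i-2}-2j+1}{2^{i-2}}$, such that the function $$f^{(p)}(x)=w_{-1}b^1_{-1}(x)+w_{+1}b^1_{+1}(x)+w'_0\,b^2_0(x)+\sum_{i=3}^{p}\sum_{j=1}^{2^{i-3}}\Big(w'_{-c_{i,j}}\,b^i_{-c_{i,j}}(x)+w'_{c_{i,j}}\,b^i_{c_{i,j}}(x)\Big)$$ satisfies $f^{(p)}(x)=f(x)$ for every $x\in G_p$.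
   Context: A perception base function is a non-decreasing function $b:[-1,1]\to[0,1]$ with $b(-1)=0$, $b(0)=\tfrac12$, $b(1)=1$ and $b(-x)=1-b(x)$ for all $x\in[-1,1]$ (for example $b(x)=\tfrac12(1+x)$ or $b(x)=\tfrac12(1+\sin(\tfrac{\pi}{2}x))$). From $b$ the fundamental bases functions on $[-1,1]$ are built as follows. Level 1: $b^1_{+1}(x)=b(x)$ and $b^1_{-1}(x)=1-b(x)$. Level 2: $b^2_0(x)=b(2x+1)$ for $x\in[-1,0]$ and $b^2_0(x)=1-b(2x-1)$ for $x\in[0,1]$; extend $b^2_0$ to all of $\mathbb{R}$ by setting it equal to $0$ outside $[-1,1]$. Level $i\ge 3$: for $1\le j\le 2^{i-3}$ and $c_{i,j}=\frac{2^{i-2}-2j+1}{2^{i-2}}$, set $b^i_{\pm c_{i,j}}(x)=b^2_0\big(2^{i-2}(x\mp c_{i,j})\big)$. The values of $f$ are logical values in $[0,1]$. When $p=2$ the double sum over $i$ is empty. *)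

(* Defs.v *)
From HB Require Import structures.
From mathcomp Require Import all_boot all_order all_algebra.
From mathcomp Require Import classical_sets reals.

Set Implicit Arguments.
Unset Strict Implicit.
Unset Printing Implicit Defensive.

Import Order.TTheory GRing.Theory Num.Theory.
Local Open Scope classical_set_scope.
Local Open Scope ring_scope.

(* A function [-1, 1] -> [0, 1] is a total function R -> R whose values
   outside [-1, 1] are irrelevant. *)
Definition perception_base (R : realType) (b : R -> R) : Prop :=
  (forall x : R, -1 <= x <= 1 -> 0 <= b x <= 1) /\
  (forall x y : R, -1 <= x -> x <= y -> y <= 1 -> b x <= b y) /\
  b (-1) = 0 /\ b 0 = 1 / 2 /\ b 1 = 1 /\
  (forall x : R, -1 <= x <= 1 -> b (- x) = 1 - b x).

Definition base1_pos (R : realType) (b : R -> R) (x : R) : R := b x.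

Definition base1_neg (R : realType) (b : R -> R) (x : R) : R := 1 - b x.

(* At the common point 0 both formulas give 1 when b is a perception base. *)
Definition base2 (R : realType) (b : R -> R) (x : R) : R :=
  if -1 <= x <= 0 then b (2 * x + 1)
  else if 0 <= x <= 1 then 1 - b (2 * x - 1)
  else 0.

Definition center (R : realType) (i j : nat) : R :=
  (2 ^+ (i - 2) - 2 * j%:R + 1) / 2 ^+ (i - 2).

Definition base_level (R : realType) (b : R -> R) (i : nat) (c x : R) : R :=
  base2 b (2 ^+ (i - 2) * (x - c)).

Definition grid (R : realType) (p : nat) : set R :=
  [set x | x = -1 \/ x = 0 \/ x = 1 \/
    exists j : nat, (1 <= j <= 2 ^ (p - 2) - 1)%N /\
      (x = (2 ^+ (p - 2) - j%:R) / 2 ^+ (p - 2) \/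
       x = - ((2 ^+ (p - 2) - j%:R) / 2 ^+ (p - 2)))].

Arguments grid R p _ : clear implicits.

(* wn i j and wp i j are the weights of the bases at - center i j and
   center i j; only 3 <= i <= p and 1 <= j <= 2 ^ (i - 3) matter. *)
Definition multi_perceptual (R : realType) (b : R -> R) (p : nat)
    (wm1 wp1 w0 : R) (wn wp : nat -> nat -> R) (x : R) : R :=
  wm1 * base1_neg b x + wp1 * base1_pos b x + w0 * base2 b x +
  \sum_(3 <= i < p.+1) \sum_(1 <= j < (2 ^ (i - 3)).+1)
    (wn i j * base_level b i (- center R i j) x +
     wp i j * base_level b i (center R i j) x).

(* Main.v *)
(* Refining the resolution from [p] to [p + 1] adds to the grid exactly the
   odd multiples of [1 / 2 ^ (p - 1)], which are the centers of the bases of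
   level [p + 1].  Each of these bases is [1] at its own center and [0] at all
   other points of the refined grid, so the weights of the lower levels can be
   kept, and the weight at a new center is the error left there by the
   representation of resolution [p]. *)
Require Import Defs.
From mathcomp Require Import all_boot all_order all_algebra.
From mathcomp Require Import classical_sets reals.
From mathcomp Require Import zify ring lra.

Import Order.TTheory GRing.Theory Num.Theory.
Local Open Scope classical_set_scope.
Local Open Scope ring_scope.

(** At -1, 0 and 1 the argument passed to [b] is an endpoint of [-1, 1], where [b] is prescribed. *)
Lemma base2_int (R : realType) (b : R -> R) (n : int) :
  perception_base b -> base2 b n%:~R = (n == 0)%:R.
Proof.
move=> [_ [_ [bN1 [_ [b1 _]]]]]; rewrite /base2.
have -> : (-1 <= (n%:~R : R) <= 0) = (-1 <= n <= 0).
  by rewrite lerz0 -[X in X <= _%:~R]/((-1)%:~R) ler_int.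
have -> : (0 <= (n%:~R : R) <= 1) = (0 <= n <= 1).
  by rewrite ler0z lerz1.
case: ifPn => [n_le0|n_out].
  have [->|->] : n = -1 \/ n = 0 by lia.
    by rewrite (_ : 2 * _ + 1 = -1) ?bN1 //; ring.
  by rewrite (_ : 2 * _ + 1 = 1) ?b1 //; ring.
(* What remains is [n = 1], or [|n| >= 2], where [base2] takes its default value 0. *)
case: ifPn => [n_ge0|n_far]; last by rewrite (_ : (n == 0) = false) //; lia.
have -> : n = 1 by lia.
by rewrite (_ : 2 * _ - 1 = 1) ?b1 ?subrr //; ring.
Qed.

(** As [j] runs over 1, ..., 2^m, this runs down the odd numbers from 2^(m+1) - 1 to 1. Working in
    [int] reduces comparisons of centers to linear arithmetic. *)
Definition center_num (m j : nat) : int := (2 ^ m.+1)%:Z - (2 * j)%:Z + 1.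

Lemma centerE (R : realType) (m j : nat) :
  center R m.+3 j = (center_num m j)%:~R / 2 ^+ m.+1.
Proof.
rewrite /center /center_num !subSS subn0.
by rewrite rmorphD rmorphB -natrX -natrM.
Qed.

(** The dilation by 2^(m+1) in the basis cancels the common denominator, leaving [base2] at the
    integer [k - n]. *)
Lemma base_level_dyadic (R : realType) (b : R -> R) (m : nat) (n k : int) :
  perception_base b ->
  base_level b m.+3 (n%:~R / 2 ^+ m.+1) (k%:~R / 2 ^+ m.+1) = (k == n)%:R.
Proof.
move=> hb; rewrite /base_level !subSS subn0 -mulrBl mulrC.
rewrite divfK ?expf_neq0 ?pnatr_eq0 //.
by rewrite -rmorphB base2_int // subr_eq0.
Qed.

Definition level_sum {R : realType} (b : R -> R) (i : nat) (un up : nat -> R)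
    (x : R) : R :=
  \sum_(1 <= j < (2 ^ (i - 3)).+1)
    (un j * base_level b i (- center R i j) x +
     up j * base_level b i (center R i j) x).

Lemma level_sum_dyadic (R : realType) (b : R -> R) (m : nat)
    (un up : nat -> R) (k : int) : perception_base b ->
  level_sum b m.+3 un up (k%:~R / 2 ^+ m.+1) =
  \sum_(1 <= j < (2 ^ m).+1)
    (un j * (k == - center_num m j)%:R + up j * (k == center_num m j)%:R).
Proof.
move=> hb; rewrite /level_sum !subSS subn0; apply: eq_bigr => j _.
by rewrite centerE -mulNr -rmorphN !base_level_dyadic.
Qed.

(** Numerators of centers are odd, so a new level leaves the values on the coarser grid
    untouched. *)
Lemma level_sum_even (R : realType) (b : R -> R) (m : nat)
    (un up : nat -> R) (l : int) : perception_base b ->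
  level_sum b m.+3 un up ((2 * l)%:~R / 2 ^+ m.+1) = 0.
Proof.
move=> hb; rewrite level_sum_dyadic // big1 // => j _.
have -> : (2 * l == - center_num m j) = false by rewrite /center_num expnS; lia.
have -> : (2 * l == center_num m j) = false by rewrite /center_num expnS; lia.
by rewrite !mulr0 addr0.
Qed.

Lemma level_sum_center {R : realType} {b : R -> R} {m j : nat}
    (un up : nat -> R) : perception_base b -> (1 <= j <= 2 ^ m)%N ->
  level_sum b m.+3 un up (center R m.+3 j) = up j /\
  level_sum b m.+3 un up (- center R m.+3 j) = un j.
Proof.
move=> hb hj; rewrite centerE -mulNr -rmorphN !level_sum_dyadic //.
have j_in : j \in index_iota 1 (2 ^ m).+1 by rewrite mem_index_iota.
(* Only the term of index [j] survives: for indices in range the numerators are positive, so no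
   center equals the opposite of another, and they are injective in the index. *)
rewrite !(bigD1_seq j) ?iota_uniq //= !eqxx.
have -> : (center_num m j == - center_num m j) = false
  by rewrite /center_num expnS; lia.
have -> : (- center_num m j == center_num m j) = false
  by rewrite /center_num expnS; lia.
rewrite !big1_seq ?mulr0 ?mulr1 ?addr0 ?add0r // => i /andP[ij].
- rewrite mem_index_iota => hi.
  have -> : (- center_num m j == - center_num m i) = false
    by rewrite /center_num expnS; lia.
  have -> : (- center_num m j == center_num m i) = false
    by rewrite /center_num expnS; lia.
  by rewrite !mulr0 addr0.
- rewrite mem_index_iota => hi.
  have -> : (center_num m j == - center_num m i) = false
    by rewrite /center_num expnS; lia.
  have -> : (center_num m j == center_num m i) = false
    by rewrite /center_num expnS; lia.
  by rewrite !mulr0 addr0.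
Qed.

Lemma multi_perceptualS (R : realType) (b : R -> R) (m : nat)
    (wm1 wp1 w0 : R) (wn wp : nat -> nat -> R) (un up : nat -> R) (x : R) :
  multi_perceptual b m.+3 wm1 wp1 w0
    (fun i => if i == m.+3 then un else wn i)
    (fun i => if i == m.+3 then up else wp i) x =
  multi_perceptual b m.+2 wm1 wp1 w0 wn wp x + level_sum b m.+3 un up x.
Proof.
rewrite /multi_perceptual big_nat_recr //= addrA eqxx; congr (_ + _ + _).
by apply: eq_big_nat => i /andP[_ hi]; rewrite (_ : i == m.+3 = false) //; lia.
Qed.

Lemma dyadic_cases {m : nat} {k : int} : `|k| <= (2 ^ m.+1)%:Z ->
  (exists2 l : int, `|l| <= (2 ^ m)%:Z & k = 2 * l) \/
  (exists2 j : nat, (1 <= j <= 2 ^ m)%N &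
     k = center_num m j \/ k = - center_num m j).
Proof.
rewrite /center_num expnS => hk.
have [[l kE]|[l kE]] : (exists l : int, k = 2 * l) \/
    (exists l : nat, `|k| = (2 * l + 1)%:Z).
  case ok: (odd `|k|%N); [right; exists (`|k|./2)%N | left; exists (k %/ 2)%Z];
  lia.
  by left; exists l; lia.
(* Solving [center_num m j = 2 * l + 1] gives this index. Being odd, [|k|] is below 2^(m+1), so
   [l < 2 ^ m]: the subtraction is exact and the index at least 1. *)
by right; exists (2 ^ m - l)%N; lia.
Qed.

Lemma multi_perceptual_dyadic {R : realType} {b : R -> R} (f : R -> R)
    (m : nat) : perception_base b ->
  exists (wm1 wp1 w0 : R) (wn wp : nat -> nat -> R),
    forall k : int, `|k| <= (2 ^ m)%:Z ->
      multi_perceptual b m.+2 wm1 wp1 w0 wn wp (k%:~R / 2 ^+ m) =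
      f (k%:~R / 2 ^+ m).
Proof.
move=> hb; elim: m => [|m [wm1 [wp1 [w0 [wn [wp IHm]]]]]].
  (* At -1 and 1 a single level-1 basis is 1 and the other bases vanish. At 0 both level-1 bases are
     1/2 and [base2] is 1, so its weight corrects the mean of the end values. *)
  exists (f (-1)), (f 1), (f 0 - (f (-1) + f 1) / 2).
  exists (fun _ _ => 0), (fun _ _ => 0) => k hk.
  rewrite /multi_perceptual big_geq // addr0 expr0 divr1 base2_int //.
  rewrite /base1_neg /base1_pos.
  case: hb => _ [_ [bN1 [b0 [b1 _]]]].
  have [->|[->|->]] : k = -1 \/ k = 0 \/ k = 1 by lia.
  - by rewrite rmorphN /= bN1; lra.
  - by rewrite /= b0; lra.
  - by rewrite /= b1; lra.
pose err x := f x - multi_perceptual b m.+2 wm1 wp1 w0 wn wp x.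
pose un j := err (- center R m.+3 j); pose up j := err (center R m.+3 j).
exists wm1, wp1, w0, (fun i => if i == m.+3 then un else wn i),
  (fun i => if i == m.+3 then up else wp i) => k hk.
rewrite multi_perceptualS.
have [[l hl ->]|[j hj kE]] := dyadic_cases hk.
  (* An even numerator reduces to the point [l / 2^m] of the previous grid. *)
  rewrite level_sum_even // addr0.
  have -> : (2 * l)%:~R / 2 ^+ m.+1 = l%:~R / 2 ^+ m :> R.
    by rewrite rmorphM exprS -mulf_div divff ?pnatr_eq0 ?mul1r.
  exact: IHm.
have [sum_up sum_un] := level_sum_center un up hb hj.
case: kE => ->; rewrite ?rmorphN ?mulNr -centerE.
  by rewrite sum_up addrC subrK.
by rewrite sum_un addrC subrK.
Qed.

(** The listed points -1, 0 and 1 have numerators -2^m, 0 and 2^m, and the others have numerators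
    2^m - j up to sign. *)
Lemma grid_dyadic (R : realType) (m : nat) (x : R) : grid R m.+2 x ->
  exists2 k : int, `|k| <= (2 ^ m)%:Z & x = k%:~R / 2 ^+ m.
Proof.
have p2 : (0 < 2 ^ m)%N by rewrite expn_gt0.
have n2 : 2 ^+ m != 0 :> R by rewrite expf_neq0 // pnatr_eq0.
have E2 : (2 ^ m)%:Z%:~R = 2 ^+ m :> R by rewrite -pmulrn natrX.
rewrite /grid /= !subSS subn0 => -[->|[->|[->|[j [hj xE]]]]].
- by exists (- (2 ^ m)%:Z); [lia | rewrite mulrNz E2 mulNr divff].
- by exists 0; [lia | rewrite mulr0z mul0r].
- by exists (2 ^ m)%:Z; [lia | rewrite E2 divff].
have jE : ((2 ^ m)%:Z - j%:Z)%:~R = 2 ^+ m - j%:R :> R by rewrite rmorphB -E2.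
case: xE => ->; rewrite -jE.
  by exists ((2 ^ m)%:Z - j%:Z); [lia |].
by exists (- ((2 ^ m)%:Z - j%:Z)); [lia | rewrite rmorphN mulNr].
Qed.

Theorem theorem6p3 (R : realType) (b : R -> R) (p : nat) (f : R -> R)
  (hb : perception_base b) (hp : (2 <= p)%N)
  (hf : forall x : R, grid R p x -> 0 <= f x <= 1) :
  exists (wm1 wp1 w0 : R) (wn wp : nat -> nat -> R),
    forall x : R, grid R p x ->
      multi_perceptual b p wm1 wp1 w0 wn wp x = f x.
Proof.
case: p hp hf => [|[|m]] // _ _.
have [wm1 [wp1 [w0 [wn [wp wE]]]]] := multi_perceptual_dyadic f m hb.
exists wm1, wp1, w0, wn, wp => x /grid_dyadic[k hk ->].
exact: wE.
Qed.
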